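(* Let $\Gamma=\Gamma(V,E)$ be a finite directed multigraph, and let $\alpha:E\to\mathbb{R}_+$ be a positive weighting of the edges of $\Gamma$. Fix a non-empty finite set $C$, whose elements are called colours, and let $c:E\to C$ be an edge colouring of $\Gamma$ (which need not be proper). For $v\in V$ and a colour $c\in C$ denote by $\Gamma_c^-(v)$ the set of edges of colour $c$ entering $v$, and by $\Gamma_c^+(v)$ the set of edges of colour $c$ leaving $v$. Consider the real variables $\{N(v):v\in V\}\cup\{s(e):e\in E\}$ and the system of linear inequalities \begin{align*} (1)\quad & N(v)\ge 0, && (v\in V)\\ (2)\quad & s(e)\ge 0, && (e\in E)\\ (3)\quad & \sum_{e\in\Gamma_c^-(v)} s(e)\le N(v), && (v\in V,\ c\in C)\\ (4)\quad & \sum_{e\in\Gamma_c^+(v)}\alpha(e)s(e)\ge N(v), && (v\in V,\ c\in C,\ \Gamma_c^+(v)\neq\emptyset). \end{align*} Let $C(v)=\{c\in C:\Gamma_c^-(v)\ne\emptyset\}$ be the set of colours entering $v$. For each $v\in V$ which is not a source, let $\lambda_c(v)$, $c\in C(v)$, be positive numbers such that $\sum_{c\in C(v)}\lambda_c(v)\le 1$. For each edge $e\in E$ from a vertex $v$ to a vertex $w$, define $\hat\alpha(e)=\alpha(e)/\lambda_{c(e)}(w)$. Extend this function to any directed path $P$ by $\hat\alpha(P)=\prod_{e\in P}\hat\alpha(e)$. Suppose that $Y,Z\subseteq V$ satisfy: 1. $Z\neq\emptyset$ and $Y\cap Z=\emptyset$; 2. if $v\in V$ is a sink of $\Gamma$,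 or if $\hat\alpha(e)\ge 1$ for some edge $e$ leaving $v$, then $v\in Z$. For any $W,W'\subseteq V$, define $\mathcal{P}(W,W')$ to be the set of non-trivial directed paths in $\Gamma$ which start in $W$, end in $W'$, and have no internal vertices in $Y\cup Z$. Then every solution of (1)--(4) satisfies $$\sum_{v\in Y}N(v)\le\frac{\max_{P\in\mathcal{P}(Y,Z)}\hat\alpha(P)}{1-\max_{P\in\mathcal{P}(Y,Y)}\hat\alpha(P)}\sum_{v\in Z}N(v),$$ where the maximum over an empty set is taken to be $0$.
   Context: A source is a vertex with no entering edges; a sink is a vertex with no leaving edges. A directed path is non-trivial if it has at least one edge. The start and end vertices of a path in $\mathcal{P}(W,W')$ are allowed to coincide (so a closed path, including a loop, counts as a non-trivial path from a vertex to itself). *)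

(* Defs.v *)
From HB Require Import structures.
From mathcomp Require Import all_boot all_order all_algebra reals.
Set Implicit Arguments. Unset Strict Implicit. Unset Printing Implicit Defensive.
Import Order.TTheory GRing.Theory Num.Theory.
Local Open Scope ring_scope.

(** A finite directed multigraph is given by finite types [V] and [E] and maps
    [src tgt : E -> V]; loops and parallel edges are allowed. *)

Section ColouredMultigraph.
Variables (V E C : finType) (src tgt : E -> V) (col : E -> C).

Definition in_edges (v : V) (c : C) : {set E} :=
  [set e | (tgt e == v) && (col e == c)].

Definition out_edges (v : V) (c : C) : {set E} :=
  [set e | (src e == v) && (col e == c)].

Definition is_source (v : V) : bool := [forall e, tgt e != v].

Definition is_sink (v : V) : bool := [forall e, src e != v].

Definition colours_in (v : V) : {set C} := [set c | in_edges v c != set0].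

(** A path is encoded by its non-empty sequence of edges [e_1, ..., e_n], with
    vertices [src e_1, tgt e_1 = src e_2, ..., tgt e_n].  The two [uniq]
    conditions say that the vertices are pairwise distinct, except that the
    first and the last may coincide.  The internal vertices are the sources of
    [e_2, ..., e_n]; [avoids X p] says that none of them is in [X]. *)
Definition is_dipath (p : seq E) : bool :=
  if p is e :: p' then
    [&& path (fun e1 e2 => tgt e1 == src e2) e p',
        uniq [seq src f | f <- p] & uniq [seq tgt f | f <- p]]
  else false.

Definition starts_in (W : {set V}) (p : seq E) : bool :=
  if p is e :: _ then src e \in W else false.

Definition ends_in (W : {set V}) (p : seq E) : bool :=
  if p is e :: p' then tgt (last e p') \in W else false.

Definition avoids (X : {set V}) (p : seq E) : bool :=
  all (fun f => src f \notin X) (behead p).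

Definition dipaths (Y Z W W' : {set V}) : pred (seq E) :=
  fun p => [&& is_dipath p, starts_in W p, ends_in W' p & avoids (Y :|: Z) p].

Lemma dipaths_size (Y Z W W' : {set V}) (p : seq E) :
  dipaths Y Z W W' p -> (size p <= #|V|)%N.
Proof.
case/and4P => + _ _ _; case: p => // e p /and3P[_ u _].
by rewrite -(size_map src) -(card_uniqP u) max_card.
Qed.

End ColouredMultigraph.

Section Weights.
Variables (R : realType) (V E C : finType).
Variables (src tgt : E -> V) (col : E -> C) (alpha : E -> R).

Definition is_solution (N : V -> R) (s : E -> R) : Prop :=
  [/\ forall v, 0 <= N v,
      forall e, 0 <= s e,
      forall v c, \sum_(e in in_edges tgt col v c) s e <= N v
    & forall v c, out_edges src col v c != set0 ->
        N v <= \sum_(e in out_edges src col v c) alpha e * s e].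

Variable lambda : V -> C -> R.

Definition alphahat (e : E) : R := alpha e / lambda (tgt e) (col e).

Definition alphahat_path (p : seq E) : R := \prod_(e <- p) alphahat e.

(** By [dipaths_size], the bound [#|V|] on the length, which makes the index
    type finite, excludes no path.  As the weights are positive, starting the
    maximum at [0] only matters when there is no path at all: see
    [max_alphahat_ge] and [max_alphahat_attained]. *)
Definition max_alphahat (Y Z W W' : {set V}) : R :=
  \big[Num.max/0]_(p : {bseq #|V| of E} | dipaths src tgt Y Z W W' p)
     alphahat_path p.

Lemma max_alphahat_ge (Y Z W W' : {set V}) (p : seq E) :
  dipaths src tgt Y Z W W' p -> alphahat_path p <= max_alphahat Y Z W W'.
Proof.
move=> hp; have sp := dipaths_size hp.
exact: (@le_bigmax_cond _ _ _ 0 (Bseq sp)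
  (fun p : {bseq #|V| of E} => dipaths src tgt Y Z W W' p) alphahat_path hp).
Qed.

Lemma max_alphahat_attained (Y Z W W' : {set V}) (p0 : seq E) :
  (forall e, 0 < alphahat e) -> dipaths src tgt Y Z W W' p0 ->
  exists2 p, dipaths src tgt Y Z W W' p
           & max_alphahat Y Z W W' = alphahat_path p.
Proof.
move=> pos hp0; have sp0 := dipaths_size hp0.
rewrite /max_alphahat (@bigmax_eq_arg _ _ _ 0 (Bseq sp0)) //.
  by case: arg_maxP => //= p hp _; exists p.
by move=> p _; apply: prodr_ge0 => e _; apply: ltW.
Qed.

End Weights.

(* Main.v *)
Require Import Defs.
From HB Require Import structures.
From mathcomp Require Import all_boot all_order all_algebra reals.
Set Implicit Arguments. Unset Strict Implicit. Unset Printing Implicit Defensive.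
Import Order.TTheory GRing.Theory Num.Theory.
Local Open Scope ring_scope.

(** Put [t e = lambda * s e], with [lambda] taken at the head and the colour of
    [e].  Summing (3) over the colours with weights [lambda], and keeping (4) for
    one colour at each non-sink, removes the colours: the total [t]-flow into [w]
    is at most [N w], and [N v] is at most the total of [alphahat * t] out of [v]
    when [v] is not a sink.  Let [h w] be the largest weight of a path in
    [P(Y, {w})], and let [g] be [1] on [Y], [0] on [Z] and [h] elsewhere.  Then
    [g v * alphahat e <= h w] for each edge [e] from [v] to [w]: a best path to
    [v] followed by [e] is either a path again or closes a cycle of weight at
    most [1], which can be dropped.  Hence [\sum g N <= \sum h N].  The terms
    outside [Y] and [Z] cancel, [h <= max P(Y, Z)] on [Z] and
    [h <= max P(Y, Y) < 1] on [Y]. *)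

Section Dipaths.
Variables (V E : finType) (src tgt : E -> V).
Implicit Types (e f : E) (p : seq E) (W Y Z : {set V}).

Let joins e f := tgt e == src f.

(** Lets distinctness of the targets of a path rule out repeated sources after the first edge. *)
Lemma map_src_path e p :
  path joins e p -> map src p = belast (tgt e) (map tgt p).
Proof. by elim: p e => //= f p IHp e /andP[/eqP-> /IHp->]. Qed.

Lemma dipaths1 Y Z W e : src e \in W -> dipaths src tgt Y Z W [set tgt e] [:: e].
Proof. by move=> We; rewrite /dipaths /is_dipath /= /avoids /= set11 We. Qed.

Lemma dipaths_subr Y Z W W1 W2 p :
  W1 \subset W2 -> dipaths src tgt Y Z W W1 p -> dipaths src tgt Y Z W W2 p.
Proof.
move=> sW /and4P[dp sp ep ap]; apply/and4P; split=> //.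
by case: p ep {dp sp ap} => //= e p; apply: (subsetP sW).
Qed.

(** The only new source is [v]. It differs from the start of [p], which lies in [Y :|: Z], and from
    the internal vertices, which are earlier targets than the last one, [v]. *)
Lemma dipaths_rcons Y Z W v e p :
    W \subset Y :|: Z -> v \notin Y :|: Z -> src e = v ->
    dipaths src tgt Y Z W [set v] p -> tgt e \notin map tgt p ->
  dipaths src tgt Y Z W [set tgt e] (rcons p e).
Proof.
move=> sW nv ev; case: p => [|f p] // /and4P[/and3P[fp us ut] sf lv av] ne.
have {}lv : tgt (last f p) = v by move: lv; rewrite /= inE => /eqP.
have us' : uniq (rcons (map src (f :: p)) (src e)).
  rewrite rcons_uniq us andbT map_cons in_cons negb_or ev (map_src_path fp).
  apply/andP; split.
    by apply: contraNneq nv => ->; apply: (subsetP sW).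
  by move: ut; rewrite map_cons lastI rcons_uniq last_map lv; case/andP.
have ut' : uniq (rcons (map tgt (f :: p)) (tgt e)) by rewrite rcons_uniq ne.
move: us' ut'; rewrite -!map_rcons => us' ut'.
apply/and4P; split=> //=.
- by apply/and3P; split=> //; rewrite rcons_path fp lv ev /=.
- by rewrite last_rcons set11.
- by rewrite /avoids /= all_rcons ev nv.
Qed.

Lemma dipaths_prefix Y Z W W' p f q :
    dipaths src tgt Y Z W W' (p ++ f :: q) ->
  dipaths src tgt Y Z W [set tgt f] (rcons p f).
Proof.
rewrite -cat_rcons; case: p => [|e p] /=.
  case/and4P=> _ sf _ _; exact: dipaths1.
rewrite /dipaths /is_dipath /avoids /= last_rcons set11.
rewrite cat_path !map_cat all_cat !mem_cat !negb_or !cat_uniq.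
case/and4P=> /and3P[/andP[-> _] /andP[/andP[-> _] /andP[-> _]]].
by move=> /andP[/andP[-> _] /andP[-> _]] -> _ /andP[-> _].
Qed.

Lemma dipaths_src_notin Y Z W W' p :
    [disjoint W & Z] -> dipaths src tgt Y Z W W' p ->
  {in p, forall e, src e \notin Z}.
Proof.
move=> dWZ; case: p => // f p /and4P[_ sf _ /allP ap] e.
rewrite inE => /predU1P[->|/ap]; first by rewrite (disjointFr dWZ).
by rewrite inE negb_or => /andP[].
Qed.

End Dipaths.

Section MaxWeight.
Variables (R : realType) (V E C : finType).
Variables (src tgt : E -> V) (col : E -> C).
Variables (alpha : E -> R) (lambda : V -> C -> R).
Variables (Y Z : {set V}).
Implicit Types (e : E) (p : seq E) (W : {set V}).

Local Notation ah := (alphahat tgt col alpha lambda).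
Local Notation ahp := (alphahat_path tgt col alpha lambda).
Local Notation maxah := (max_alphahat src tgt col alpha lambda Y Z).
Local Notation dip := (dipaths src tgt Y Z).

Hypothesis ah_gt0 : forall e, 0 < ah e.
Hypothesis ah_lt1 : forall e, src e \notin Z -> ah e < 1.

Lemma max_alphahat_ge0 W W' : 0 <= maxah W W'.
Proof. exact: bigmax_ge_id. Qed.

Lemma max_alphahat_le W W' x :
  0 <= x -> (forall p, dip W W' p -> ahp p <= x) -> maxah W W' <= x.
Proof. by move=> x0 le_x; apply: bigmax_le => // p /le_x. Qed.

Lemma max_alphahat_subr W W1 W2 : W1 \subset W2 -> maxah W W1 <= maxah W W2.
Proof.
move=> sW; apply: max_alphahat_le => [|p dp]; first exact: max_alphahat_ge0.
exact/max_alphahat_ge/(dipaths_subr sW).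
Qed.

Lemma alphahat_path_le1 p : {in p, forall e, src e \notin Z} -> ahp p <= 1.
Proof.
move=> pZ; rewrite /alphahat_path big_seq; apply: prodr_ile1 => e /pZ /ah_lt1.
by move=> /ltW ->; rewrite ltW.
Qed.

(** The first edge gives a factor strictly below 1 and the remaining ones a factor at most 1. With
    no path, the maximum is 0. *)
Lemma max_alphahat_lt1 W W' : [disjoint W & Z] -> maxah W W' < 1.
Proof.
move=> dWZ; apply/bigmax_ltP; split=> // -[[|e p] /= _] // dp.
have pZ := dipaths_src_notin dWZ dp.
rewrite /alphahat_path big_cons.
apply: le_lt_trans (ah_lt1 (pZ e (mem_head _ _))).
apply: ler_piMr; first exact/ltW.
by apply: alphahat_path_le1 => f pf; rewrite pZ // inE pf orbT.
Qed.

Lemma alphahat_le_max W e : src e \in W -> ah e <= maxah W [set tgt e].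
Proof.
move=> We; have := max_alphahat_ge col alpha lambda (dipaths1 tgt Y Z We).
by rewrite /alphahat_path big_seq1.
Qed.

Lemma max_alphahat_edge W e :
    W \subset Y :|: Z -> [disjoint W & Z] -> src e \notin Y :|: Z ->
  maxah W [set src e] * ah e <= maxah W [set tgt e].
Proof.
(* Dividing by [ah e] leaves the maximum alone on the left, so it can be bounded path by path. *)
move=> sW dWZ ne; rewrite -ler_pdivlMr //.
apply: max_alphahat_le => [|p dp].
  by rewrite divr_ge0 ?max_alphahat_ge0 // ltW.
rewrite ler_pdivlMr //; have [tp|tp] := boolP (tgt e \in map tgt p); last first.
  have := max_alphahat_ge col alpha lambda (dipaths_rcons sW ne erefl dp tp).
  by rewrite /alphahat_path -cats1 big_cat big_seq1.
have pZ := dipaths_src_notin dWZ dp.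
(* Here [f] is the edge of [p] that already reaches [tgt e]. The path up to [f] is kept; [p2]
   followed by [e] is the cycle to drop. *)
case/mapP: tp dp pZ => f /path.splitPr[p1 p2] -> dp pZ.
apply: le_trans (max_alphahat_ge col alpha lambda (dipaths_prefix dp)).
rewrite /alphahat_path -cat_rcons big_cat /= -mulrA; apply: ler_piMr.
  by apply: prodr_ge0 => g _; apply: ltW.
have := @alphahat_path_le1 (rcons p2 e).
rewrite /alphahat_path -cats1 big_cat big_seq1; apply=> g.
rewrite mem_cat inE => /orP[gp|/eqP->].
  by apply: pZ; rewrite mem_cat inE gp !orbT.
by apply: contra ne => eZ; rewrite inE eZ orbT.
Qed.

End MaxWeight.

Section Flows.
Variables (R : realType) (V E : finType) (src tgt : E -> V).
Variables (a t : E -> R) (N : V -> R).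

(* Weak duality between the flow constraints and the potentials [g], [h]. *)
Lemma flow_potential_le (g h : V -> R) :
    (forall e, 0 <= t e) -> (forall v, 0 <= g v) -> (forall v, 0 <= h v) ->
    (forall v, \sum_(e | tgt e == v) t e <= N v) ->
    (forall v, g v != 0 -> N v <= \sum_(e | src e == v) a e * t e) ->
    (forall e, g (src e) * a e <= h (tgt e)) ->
  \sum_v g v * N v <= \sum_v h v * N v.
Proof.
move=> t0 g0 h0 inN outN gh.
have gE v : g v * N v <= \sum_(e | src e == v) g (src e) * a e * t e.
  have [gv0|gv0] := eqVneq (g v) 0.
    by rewrite gv0 mul0r big1 // => e /eqP->; rewrite gv0 !mul0r.
  apply: le_trans (ler_wpM2l (g0 v) (outN v gv0)) _.
  by rewrite mulr_sumr; apply: ler_sum => e /eqP->; rewrite mulrA.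
have hE v : \sum_(e | tgt e == v) h (tgt e) * t e <= h v * N v.
  apply: le_trans _ (ler_wpM2l (h0 v) (inN v)).
  by rewrite mulr_sumr ler_sum // => e /eqP->.
(* Both sides become sums over edges, grouped by tail for [g] and by head for [h], and are compared
   edge by edge. *)
apply: (@le_trans _ _ (\sum_e g (src e) * a e * t e)).
  by rewrite [leRHS](partition_big src xpredT) //; apply: ler_sum => v _; apply: gE.
apply: (@le_trans _ _ (\sum_e h (tgt e) * t e)).
  by apply: ler_sum => e _; apply: ler_wpM2r.
by rewrite (partition_big tgt xpredT) //; apply: ler_sum => v _; apply: hE.
Qed.

End Flows.

Section Decolouring.
Variables (R : realType) (V E C : finType).
Variables (src tgt : E -> V) (col : E -> C).
Variables (alpha : E -> R) (lambda : V -> C -> R).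
Variables (N : V -> R) (s : E -> R).
Hypothesis Ns_solution : is_solution src tgt col alpha N s.

Let t e := lambda (tgt e) (col e) * s e.

Lemma inflow_le v :
    (forall c, c \in colours_in tgt col v -> 0 < lambda v c) ->
    \sum_(c in colours_in tgt col v) lambda v c <= 1 ->
  \sum_(e | tgt e == v) t e <= N v.
Proof.
case: Ns_solution => N0 s0 inN _ lam0 lam1.
rewrite (partition_big col (mem (colours_in tgt col v))) /=; last first.
  move=> e /eqP ev.
  by rewrite inE; apply/set0Pn; exists e; rewrite inE ev !eqxx.
apply: le_trans (_ : \sum_(c in colours_in tgt col v) lambda v c * N v <= _).
  apply: ler_sum => c cv; apply: le_trans _ (ler_wpM2l _ (inN v c)); last exact/ltW/lam0.
  rewrite mulr_sumr le_eqVlt; apply/orP/or_introl/eqP.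
  by apply: eq_big => [e|e /andP[/eqP ev /eqP ec]]; rewrite ?inE // /t ev ec.
by rewrite -mulr_suml ler_piMl.
Qed.

Lemma outflow_ge v :
    (forall e, 0 < alpha e) -> (forall e, 0 < lambda (tgt e) (col e)) ->
    ~~ is_sink src v ->
  N v <= \sum_(e | src e == v) alphahat tgt col alpha lambda e * t e.
Proof.
case: Ns_solution => _ s0 _ outN alpha0 lam0 /forallPn[e0 /negPn ev].
have e0in : out_edges src col v (col e0) != set0.
  by apply/set0Pn; exists e0; rewrite inE ev /=.
apply: le_trans (outN _ _ e0in) _; rewrite /alphahat /t.
(* The factor [lambda] cancels, leaving [alpha e * s e]; edges of colours other than [col e0] only
   add nonnegative terms. *)
under [leRHS]eq_bigr => e _ do rewrite mulrA divfK ?gt_eqF //.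
rewrite [leRHS](bigID (fun e => col e == col e0)) /=.
under eq_bigl => e do rewrite inE.
by rewrite lerDl sumr_ge0 // => e _; rewrite mulr_ge0 // ltW.
Qed.

End Decolouring.

Theorem theorem2p1 (R : realType) (V E C : finType)
  (src tgt : E -> V) (alpha : E -> R) (col : E -> C)
  (C_nonempty : (0 < #|C|)%N)
  (alpha_gt0 : forall e, 0 < alpha e)
  (lambda : V -> C -> R)
  (lambda_gt0 : forall v, ~~ is_source tgt v ->
     forall c, c \in colours_in tgt col v -> 0 < lambda v c)
  (lambda_sum : forall v, ~~ is_source tgt v ->
     \sum_(c in colours_in tgt col v) lambda v c <= 1)
  (Y Z : {set V})
  (Z_nonempty : Z != set0)
  (YZ_disjoint : Y :&: Z = set0)
  (Z_contains : forall v,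
     is_sink src v \/
     (exists e, src e = v /\ 1 <= alphahat tgt col alpha lambda e) ->
     v \in Z)
  (N : V -> R) (s : E -> R)
  (Ns_solution : is_solution src tgt col alpha N s) :
  \sum_(v in Y) N v <=
    max_alphahat src tgt col alpha lambda Y Z Y Z /
      (1 - max_alphahat src tgt col alpha lambda Y Z Y Y) *
    \sum_(v in Z) N v.
Proof.
have lam0 e : 0 < lambda (tgt e) (col e).
  apply: lambda_gt0; first by apply/forallPn; exists e; rewrite negbK.
  by rewrite inE; apply/set0Pn; exists e; rewrite inE !eqxx.
have ah0 e : 0 < alphahat tgt col alpha lambda e by rewrite divr_gt0.
have ah1 e : src e \notin Z -> alphahat tgt col alpha lambda e < 1.
  rewrite ltNge; apply: contra => ah1.
  by apply: Z_contains; right; exists e.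
have dYZ : [disjoint Y & Z] by rewrite -setI_eq0 YZ_disjoint.
set M := max_alphahat src tgt col alpha lambda Y Z Y.
pose h v := M [set v].
(* The value 0 on [Z] neutralises the sinks, where no outflow bound is available, and the edges of
   weight at least 1. *)
pose g v := if v \in Y then 1 else if v \in Z then 0 else h v.
have h0 v : 0 <= h v by apply: max_alphahat_ge0.
have g0 v : 0 <= g v by rewrite /g; do 2?case: ifP.
have N0 : forall v, 0 <= N v by case: Ns_solution.
have gh : \sum_v g v * N v <= \sum_v h v * N v.
  apply: (@flow_potential_le _ _ _ src tgt (alphahat tgt col alpha lambda)
            (fun e => lambda (tgt e) (col e) * s e)) => //.
  - by case: Ns_solution => _ s0 _ _ e; rewrite mulr_ge0 // ltW.
  (* Nothing is assumed on [lambda] at a source, but the inflow there is an empty sum. *)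
  - move=> v; have [/forallP vsrc|nvsrc] := boolP (is_source tgt v).
      by rewrite big_pred0 // => e; apply: negbTE.
    by apply: (inflow_le Ns_solution); [apply: lambda_gt0|apply: lambda_sum].
  - move=> v gv; apply: (outflow_ge Ns_solution) => //.
    apply: contra gv => vsink; have vZ : v \in Z by apply: Z_contains; left.
    by rewrite /g vZ (disjointFl dYZ vZ).
  - move=> e; rewrite /g; have [eY|neY] := ifPn.
      by rewrite mul1r; apply: alphahat_le_max.
    have [eZ|neZ] := ifPn; first by rewrite mul0r.
    apply: max_alphahat_edge; rewrite ?subsetUl //.
    by rewrite inE negb_or neY.
have MYY1 : M Y < 1 by apply: max_alphahat_lt1.
(* The denominator is cleared and the goal written as a nonnegative difference, which dominates the
   sum of [(h v - g v) * N v] vertex by vertex. *)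
rewrite mulrAC ler_pdivlMr ?subr_gt0 // mulrC -subr_ge0.
rewrite -subr_ge0 -sumrB in gh; apply: le_trans gh _.
rewrite !mulr_sumr [X in X - _]big_mkcond [X in _ - X]big_mkcond -sumrB.
apply: ler_sum => v _; rewrite -mulrBl /g /h.
have [vY|nvY] := ifPn.
  rewrite (disjointFr dYZ vY) sub0r -mulNr opprB; apply: ler_wpM2r => //.
  by rewrite lerD2r; apply: max_alphahat_subr; rewrite sub1set.
have [vZ|nvZ] := ifPn; last by rewrite subrr mul0r subrr.
by rewrite !subr0; apply: ler_wpM2r => //; apply: max_alphahat_subr; rewrite sub1set.
Qed.
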